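(* Let $G$ be a finite simple graph with vertex set $V(G)$ and let $\varepsilon\in\mathbb F_2^{V(G)}$. Put $M(G,\varepsilon)=A(G)+D_\varepsilon$. Then the equation \[ M(G,\varepsilon)x=\varepsilon \] has a solution $x\in\mathbb F_2^{V(G)}$. Moreover, every solution $x$ satisfies \[ \varepsilon^T x\equiv \operatorname{rank}(M(G,\varepsilon))\pmod 2 . \]
   Context: All matrices and vector spaces are over the two-element field $\mathbb F_2$. $A(G)$ is the adjacency matrix of $G$ over $\mathbb F_2$, and $D_\varepsilon$ is the diagonal matrix with diagonal vector $\varepsilon$. A congruence modulo 2 between an element of $\mathbb F_2$ and an integer means that the element equals the image of the integer in $\mathbb F_2$. *)

(* Defs.v *)
From HB Require Import structures.
From mathcomp Require Import all_boot all_order all_algebra.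

Set Implicit Arguments.
Unset Strict Implicit.
Unset Printing Implicit Defensive.

Import GRing.Theory.
Local Open Scope ring_scope.

Record sgraph := SGraph {
  vertex :> finType;
  adj : rel vertex;
  adj_sym : symmetric adj;
  adj_irr : irreflexive adj
}.

(* MathComp matrices are indexed by ordinals: the vertex [v] of [G] corresponds
   to the index [enum_rank v : 'I_#|G|], and the index [i] to [enum_val i].
   In particular ['cV['F_2]_#|G|] stands for F_2^V(G). *)
Definition adjmx (G : sgraph) : 'M['F_2]_#|G| :=
  \matrix_(i, j) (adj (enum_val i) (enum_val j))%:R.

Definition loopmx (G : sgraph) (eps : 'cV['F_2]_#|G|) : 'M['F_2]_#|G| :=
  adjmx G + diag_mx eps^T.

(* Main.v *)
(** Write [M] for the symmetric matrix and [d] for its diagonal.  In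
    characteristic 2 the quadratic form of [M] is linear: [v^T M v = d^T v].
    Hence the kernel of [M] is orthogonal to [d], that is, [d] lies in the
    column space of [M].  If [M x = d], then [N = M + d d^T] has zero diagonal,
    so its rank is even, and comparing [N = (1 + d x^T) M] with [M] shows
    that [rank M = rank N] if [d^T x = 0] and [rank M = rank N + 1] if
    [d^T x = 1]. *)
Require Import Defs.
From HB Require Import structures.
From mathcomp Require Import all_boot all_order all_algebra.

Set Implicit Arguments.
Unset Strict Implicit.
Unset Printing Implicit Defensive.

Import GRing.Theory.
Local Open Scope ring_scope.

Lemma F2_mulrr (a : 'F_2) : a * a = a.
Proof. by case: a => [[|[|//]]] /= ?; apply: val_inj. Qed.

Lemma F2_eq01 (a : 'F_2) : a = 0 \/ a = 1.
Proof. by case: a => [[|[|//]]] /= ?; [left | right]; apply: val_inj. Qed.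

Lemma F2_natr n : n%:R = (odd n)%:R :> 'F_2.
Proof. by rewrite -modn2 Fp_nat_mod. Qed.

Lemma mx_addrr_F2 m n (A : 'M['F_2]_(m, n)) : A + A = 0.
Proof. by apply/matrixP => i j; rewrite !mxE; apply/addrr_pchar2/pchar_Fp. Qed.

Definition diag_col (R : Type) n (M : 'M[R]_n) : 'cV[R]_n := \col_i M i i.

(** The strictly upper part [U] and its transpose contribute equal scalars, which cancel in
    characteristic 2. Only the terms [M k k * v_k ^ 2] remain, and [v_k ^ 2 = v_k] in F_2. *)
Lemma quad_form_diag n (M : 'M['F_2]_n) (v : 'cV_n) :
  M^T = M -> v^T *m M *m v = v^T *m diag_col M.
Proof.
move=> symM; pose U : 'M['F_2]_n := \matrix_(i, j) (M i j *+ (i < j)%N).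
have -> : M = U + U^T + diag_mx (diag_col M)^T.
  apply/matrixP => i j; rewrite !mxE.
  have -> : M j i = M i j by rewrite -[in LHS]symM mxE.
  case: (ltngtP i j) => [lt_ij|lt_ji|/val_inj->].
  - by rewrite -val_eqE /= (ltn_eqF lt_ij) !addr0.
  - by rewrite -val_eqE /= (gtn_eqF lt_ji) addr0 add0r.
  - by rewrite eqxx !add0r.
rewrite !mulmxDr !mulmxDl.
have -> : v^T *m U^T *m v = v^T *m U *m v.
  by rewrite [RHS]mx11_scalar -tr_scalar_mx -mx11_scalar !trmx_mul trmxK mulmxA.
rewrite mx_addrr_F2 add0r mul_mx_diag.
apply/matrixP => i j; rewrite !mxE; apply: eq_bigr => k _.
by rewrite !mxE eqxx !ltnn mulr0n !add0r (ord1 j) (ord1 i) mulrAC F2_mulrr.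
Qed.

Lemma diag_col_submx n (M : 'M['F_2]_n) :
  M^T = M -> exists x : 'cV_n, M *m x = diag_col M.
Proof.
move=> symM.
suff /submxP [y Ey] : ((diag_col M)^T <= M)%MS.
  by exists y^T; rewrite -[in LHS]symM -trmx_mul -Ey trmxK.
rewrite submxE; apply/eqP/trmx_inj; rewrite trmx_mul trmxK trmx0.
apply/row_matrixP => i; rewrite row_mul row0.
(* By symmetry of [M], each row [w] of the transposed cokernel lies in the left kernel of [M], so
   [w d = w M w^T = 0] for the diagonal [d]. *)
set w := row i _; have wM : w *m M = 0.
  by rewrite /w -row_mul -[X in _ *m X]symM -trmx_mul mulmx_coker trmx0 row0.
by rewrite -[w]trmxK -quad_form_diag // trmxK wM mul0mx.
Qed.

(** Transposing gives [\det A = (-1)^n * \det A]. This is informative only where 2 is nonzero,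
    whence the detour through the integers for matrices over F_2. *)
Lemma det_skew_odd (R : idomainType) n (A : 'M[R]_n) :
  [pchar R] =i pred0 -> odd n -> A^T = - A -> \det A = 0.
Proof.
move=> chR odd_n skewA; apply/eqP.
have /eqP : \det A = - \det A.
  by rewrite -[LHS]det_tr skewA -scaleN1r detZ -signr_odd odd_n mulN1r.
by rewrite -addr_eq0 -mulr2n -mulr_natr mulf_eq0 ((pcharf0P R).1 chR) orbF.
Qed.

(* A zero-diagonal symmetric matrix over F_2 is the reduction of a
   skew-symmetric integer matrix. *)
Lemma det_alternating_odd n (A : 'M['F_2]_n) :
  A^T = A -> diag_col A = 0 -> odd n -> \det A = 0.
Proof.
move=> symA diagA odd_n.
(* Lift the entries above the diagonal to 0 or 1 and negate their mirror images; the sign disappears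
   modulo 2. *)
pose T : 'M[int]_n := \matrix_(i, j)
  ((A i j : nat)%:Z *+ (i < j)%N - (A j i : nat)%:Z *+ (j < i)%N).
have skewT : T^T = - T by apply/matrixP => i j; rewrite !mxE opprB.
have -> : A = map_mx intr T.
  apply/matrixP => i j; rewrite !mxE.
  have -> : A j i = A i j by rewrite -[in LHS]symA mxE.
  have AE : ((A i j : nat)%:R : 'F_2) = A i j by rewrite natr_Zp.
  case: (ltngtP i j) => [_|_|/val_inj->].
  - by rewrite subr0 mulr1n -pmulrn AE.
  - rewrite sub0r mulr1n rmorphN /= -pmulrn AE.
    by rewrite (oppr_pchar2 (pchar_Fp _)).
  - by rewrite subrr; move/matrixP/(_ j 0): diagA; rewrite !mxE.
by rewrite det_map_mx (det_skew_odd _ odd_n skewT) ?rmorph0 //; apply: Num.Theory.pchar_num.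
Qed.

(* With [P] a right inverse of a row basis [R] of [M], the matrix [P^T M P] is an
   invertible alternating matrix of size [\rank M]. *)
Lemma odd_rank_alternating n (M : 'M['F_2]_n) :
  M^T = M -> diag_col M = 0 -> odd (\rank M) = false.
Proof.
move=> symM diagM.
have [R [P [subMR RP]]] : exists R : 'M_(\rank M, n), exists P : 'M_(n, \rank M),
    (M <= R)%MS /\ R *m P = 1%:M.
  exists (row_base M), (pinvmx (row_base M)).
  by rewrite eq_row_base mulmxVp ?row_base_free.
(* [P *m R] acts as the identity on the row space of [R], which contains the rows of [M]. *)
have MPR : M *m (P *m R) = M.
  have /submxP [C EC] := subMR.
  by rewrite [X in X *m _]EC -mulmxA (mulmxA R) RP mul1mx.
pose S := P^T *m M *m P.
have ES : M = R^T *m S *m R.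
  have trMPR : R^T *m P^T *m M = M.
    by rewrite -trmx_mul -[X in _ *m X]symM -trmx_mul MPR symM.
  by rewrite /S !mulmxA trMPR -mulmxA MPR.
have unitS : S \in unitmx.
  (* [M] factors through [S], so the rank of [S] is at least [\rank M], which is its size. *)
  rewrite -row_free_unit -row_leq_rank {1}ES.
  exact: leq_trans (mxrankM_maxl _ _) (mxrankM_maxr _ _).
have symS : S^T = S by rewrite /S !trmx_mul trmxK symM mulmxA.
have diagS : diag_col S = 0.
  apply/colP => i; rewrite !mxE.
  (* A diagonal entry of [S] is the quadratic form of [M] at a column of [P]. *)
  transitivity (((col i P)^T *m M *m col i P) 0 0).
    rewrite tr_col -row_mul !mxE; apply: eq_bigr => k _; by rewrite !mxE.
  by rewrite quad_form_diag // diagM mulmx0 mxE.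
apply: contraTF unitS => /(det_alternating_odd symS diagS) detS.
by rewrite unitmxE detS unitr0.
Qed.

Lemma diag_form_rank n (M : 'M['F_2]_n) (x : 'cV_n) :
  M^T = M -> M *m x = diag_col M ->
  ((diag_col M)^T *m x) 0 0 = (\rank M)%:R.
Proof.
move=> symM; set d := diag_col M => Mx.
have xM : x^T *m M = d^T by rewrite -Mx trmx_mul symM.
pose N := M + d *m d^T.
have symN : N^T = N by rewrite /N linearD /= trmx_mul trmxK symM.
have diagN : diag_col N = 0.
  apply/colP => i; rewrite !mxE big_ord1 !mxE F2_mulrr.
  exact/addrr_pchar2/pchar_Fp.
have evenN := odd_rank_alternating symN diagN.
have EN : N = (1%:M + d *m x^T) *m M.
  by rewrite mulmxDl mul1mx -mulmxA xM.
have NM : (N <= M)%MS by rewrite EN submxMl.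
have xN : x^T *m N = d^T + (d^T *m x) *m d^T.
  rewrite mulmxDr xM mulmxA; congr (_ + _ *m _).
  by rewrite -Mx trmx_mul symM mulmxA.
case: (F2_eq01 ((d^T *m x) 0 0)) => q.
  have dx : d^T *m x = 0 by rewrite [LHS]mx11_scalar q raddf0.
  (* When [d^T x = 0], the factor [1 + d x^T] is its own inverse, so it also carries [N] back to
     [M]. *)
  have MN : (M <= N)%MS.
    have -> : M = (1%:M + d *m x^T) *m N.
      rewrite mulmxDl mul1mx -mulmxA xN dx mul0mx addr0.
      by rewrite /N -addrA mx_addrr_F2 addr0.
    exact: submxMl.
  have -> : \rank M = \rank N by apply/eqmx_rank/andP.
  by rewrite q F2_natr evenN.
have dx : d^T *m x = 1%:M by rewrite [LHS]mx11_scalar q.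
(* Now [x^T N = d^T + d^T = 0] while [x^T M = d^T] is nonzero: the kernel of [N] is strictly larger
   than that of [M]. *)
have ltNM : (\rank N < \rank M)%N.
  rewrite rank_ltmx // ltmxE NM /=; apply/negP => /submxP [C EC].
  have d0 : d^T = 0.
    rewrite -xM -[M]symM EC trmx_mul symN mulmxA xN dx mul1mx.
    by rewrite mx_addrr_F2 mul0mx.
  by move: q; rewrite d0 mul0mx mxE.
(* Adding [d d^T], of rank at most 1, raises the rank by at most 1. *)
have leMN : (\rank M <= (\rank N).+1)%N.
  have -> : M = N + d *m d^T by rewrite /N -addrA mx_addrr_F2 addr0.
  rewrite -[(\rank N).+1]addn1 (leq_trans (mxrank_add _ _)) // leq_add2l.
  exact: leq_trans (mxrankM_maxl _ _) (rank_leq_col _).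
have -> : \rank M = (\rank N).+1 by apply/eqP; rewrite eqn_leq leMN.
by rewrite q F2_natr /= evenN.
Qed.

Theorem corollary1p2 (G : sgraph) (eps : 'cV['F_2]_#|G|) :
  (exists x : 'cV['F_2]_#|G|, loopmx eps *m x = eps) /\
  (forall x : 'cV['F_2]_#|G|, loopmx eps *m x = eps ->
     (eps^T *m x) 0 0 = (\rank (loopmx eps))%:R).
Proof.
have sym : (loopmx eps)^T = loopmx eps.
  rewrite /loopmx linearD /= tr_diag_mx; congr (_ + _).
  by apply/matrixP => i j; rewrite !mxE adj_sym.
have diag : diag_col (loopmx eps) = eps.
  by apply/colP => i; rewrite !mxE adj_irr eqxx add0r.
split=> [|x]; first by have [x] := diag_col_submx sym; rewrite diag; exists x.
by have := @diag_form_rank _ _ x sym; rewrite diag.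
Qed.
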